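(* Let $G$ be a connected $r$-regular graph which is not a complete graph of odd order. Then $G$ has an IPD.
   Context: All graphs are finite and simple. The order of a path is its number of vertices. A path $P$ in $G$ is induced if the subgraph of $G$ induced on $V(P)$ is exactly $P$. A graph $G$ has an IPD (induced path decomposition) if $V(G)$ can be partitioned into sets $V_1,\dots,V_t$ such that each $G[V_i]$ is a path of order at least $2$. *)

(* Defs.v *)
From mathcomp Require Import all_boot.
Set Implicit Arguments. Unset Strict Implicit. Unset Printing Implicit Defensive.

Definition simple_graph (T : finType) (e : rel T) : Prop :=
  symmetric e /\ irreflexive e.

Definition regular (T : finType) (e : rel T) (r : nat) : Prop :=
  forall v : T, #|[set w | e v w]| = r.

Definition connected (T : finType) (e : rel T) : Prop :=
  forall u v : T, connect e u v.

Definition complete (T : finType) (e : rel T) : Prop :=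
  forall u v : T, u != v -> e u v.

Definition induces_path (T : finType) (e : rel T) (S : {set T}) (x0 : T) : Prop :=
  exists p : seq T,
    [/\ uniq p, [set x in p] = S &
        forall i j, i < size p -> j < size p ->
          e (nth x0 p i) (nth x0 p j) = ((i == j.+1) || (j == i.+1))].

Definition induced_path_of_order_ge2 (T : finType) (e : rel T) (S : {set T}) : Prop :=
  2 <= #|S| /\ exists x0 : T, induces_path e S x0.

Definition has_IPD (T : finType) (e : rel T) : Prop :=
  exists P : {set {set T}},
    partition P [set: T] /\ forall S, S \in P -> induced_path_of_order_ge2 e S.

(* Main.v *)
(** By a Gallai-Edmonds type argument, there is a set [S] such that the rest of the
  graph splits into pairwise non-adjacent factor-critical parts, and [S] can be
  matched into the parts.  A part matched with a vertex of [S] has a perfect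
  matching with it, hence is harmless; an unmatched part [C] is harmless when it
  contains an induced path on three vertices whose removal leaves a perfect
  matching.  Otherwise [C] is "rigid": moving the uncovered vertex along a near-perfect
  matching shows that the middle vertex of every induced path on three vertices
  is a cut vertex, so [C] is glued from odd complete graphs.  Counting degrees, a
  rigid part of a connected [r]-regular graph sends at least [r] edges to [S],
  unless it is complete and is the whole graph.  By Hall's theorem the rigid parts
  can then be matched into [S], and by Mendelsohn-Dulmage a single matching covers
  both [S] and all the rigid parts. *)

Require Import Defs.
From mathcomp Require Import all_boot.
From mathcomp Require Import zify.

Set Implicit Arguments. Unset Strict Implicit. Unset Printing Implicit Defensive.

Ltac set_cases :=
  rewrite ?inE;
  repeat match goal with
  | H : is_true (?a != ?a) |- _ => by rewrite eqxx in H
  | H : is_true (?a \in ?C) |- context [?a \in ?C] => rewrite H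
  | H : is_true (?a \notin ?C) |- context [?a \in ?C] => rewrite (negPf H)
  | H : is_true (?a != ?b) |- context [?a == ?b] => rewrite (negPf H)
  | H : is_true (?a != ?b) |- context [?b == ?a] => rewrite (eq_sym b a) (negPf H)
  | |- context [?a == ?a] => rewrite eqxx
  | |- context [?a == ?b] => case: (eqVneq a b) => [?|?]; [subst|]
  | |- context [?a \in ?C] => let h := fresh in case: (boolP (a \in C)) => h
  end; rewrite /= ?andbT ?andbF ?orbT ?orbF //=.

Ltac set_ext := let w := fresh "w" in apply/setP => w; set_cases.

Ltac set_bool :=
  let w := fresh "w" in apply/setP => w; rewrite !inE;
  repeat match goal with |- context [w == ?b] => case: (w == b) end;
  rewrite /= ?andbT ?andbF ?orbT ?orbF //=.

(** * Hall's marriage theorem and the merging of two matchings *)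

Section Hall.
Variables (A B : finType).

Definition nbhd (R : A -> B -> bool) (X : {set A}) : {set B} :=
  [set b | [exists a in X, R a b]].

Lemma nbhdP (R : A -> B -> bool) (X : {set A}) b :
  reflect (exists2 a, a \in X & R a b) (b \in nbhd R X).
Proof. by rewrite inE; apply: (iffP exists_inP). Qed.

(** Induction on the size of [X], split by whether some nonempty proper subset is tight, that is,
    has no more neighbours than elements. *)
Lemma hall_marriage (b0 : B) (R : A -> B -> bool) (X : {set A}) :
  (forall Y : {set A}, Y \subset X -> #|Y| <= #|nbhd R Y|) ->
  exists f : A -> B, {in X &, injective f} /\ {in X, forall a, R a (f a)}.
Proof.
have [n] := ubnP #|X|; elim: n R X => // n IH R X /ltnSE leXn hall.
have [X0|[a aX]] := set_0Vmem X.
  by exists (fun=> b0); split=> ? => [?|]; rewrite X0 inE.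
have [/existsP[Y /and4P[sYX Yn0 ltYX tightY]]|noTight] :=
    boolP [exists Y : {set A}, [&& Y \subset X, Y != set0, #|Y| < #|X|
                                 & #|nbhd R Y| <= #|Y|]].
- have [|Z sZY|f [injf Rf]] := IH R Y; first exact: leq_trans leXn.
    by apply: hall; apply: subset_trans sYX.
  (* Elements outside the tight [Y] are matched outside its neighbourhood: Hall's condition for
     [Z :|: Y] leaves at least [#|Z|] new neighbours for [Z]. *)
  pose R' a b := R a b && (b \notin nbhd R Y).
  have cardD : #|X :\: Y| = #|X| - #|Y| by rewrite cardsD (setIidPr sYX).
  have Ygt0 : 0 < #|Y| by rewrite card_gt0.
  have [||g [injg Rg]] := IH R' (X :\: Y); first by rewrite cardD; lia.
    move=> Z sZ.
    have dZY : [disjoint Z & Y] by move: sZ; rewrite subsetD => /andP[].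
    have sZX : Z \subset X by move: sZ; rewrite subsetD => /andP[].
    have := hall (Z :|: Y); rewrite subUset sZX sYX => /(_ isT).
    rewrite cardsU disjoint_setI0 // cards0 subn0.
    have: nbhd R (Z :|: Y) \subset nbhd R' Z :|: nbhd R Y.
      apply/subsetP=> b /nbhdP[c cZY Rcb]; rewrite in_setU; rewrite in_setU in cZY.
      have [_|bY] := boolP (b \in nbhd R Y); first by rewrite orbT.
      case/orP: cZY => [cZ|cY].
        by apply/orP; left; apply/nbhdP; exists c => //; rewrite /R' Rcb.
      by case/nbhdP: bY; exists c.
    move=> /subset_leq_card; rewrite cardsU; lia.
  exists (fun a => if a \in Y then f a else g a); split=> [c d cX dX|c cX] /=.
    case: ifPn => cY; case: ifPn => dY.
    + exact: injf.
    + move=> E; have/andP[_] : R' d (g d) by apply: Rg; rewrite inE dY.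
      by rewrite -E; case/nbhdP; exists c => //; apply: Rf.
    + move=> E; have/andP[_] : R' c (g c) by apply: Rg; rewrite inE cY.
      by rewrite E; case/nbhdP; exists d => //; apply: Rf.
    + by apply: injg; rewrite inE ?cY ?dY.
  case: ifPn => cY; first exact: Rf.
  by have /andP[] : R' c (g c) by apply: Rg; rewrite inE cY.
have /card_gt0P[b /nbhdP[a']] : 0 < #|nbhd R [set a]|.
  by apply: leq_trans (hall _ _); rewrite ?cards1 ?sub1set.
rewrite inE => /eqP-> Rab {a'}.
(* Without tight subsets every nonempty proper subset has a spare neighbour, so [b] may be given to
   [a] and withdrawn from the others. *)
pose R' c d := R c d && (d != b).
have cX := cardsD1 a X; rewrite aX in cX.
have [||g [injg Rg]] := IH R' (X :\ a); first lia.
  move=> Z sZ; have [->|Zn0] := eqVneq Z set0; first by rewrite cards0.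
  have leZ := subset_leq_card sZ.
  have sZX := subset_trans sZ (subsetDl _ _).
  move: noTight; rewrite negb_exists => /forallP/(_ Z).
  rewrite sZX Zn0 /=.
  have: nbhd R Z \subset b |: nbhd R' Z.
    apply/subsetP=> d /nbhdP[c cZ Rcd]; rewrite in_setU1.
    case: (eqVneq d b) => //= db; apply/nbhdP; exists c => //.
    by rewrite /R' Rcd.
  move=> /subset_leq_card; rewrite cardsU1; lia.
exists (fun c => if c == a then b else g c); split=> [c d cX' dX|c cX'] /=.
  have gb h : h \in X -> h != a -> g h != b.
    by move=> hX ha; have /andP[] : R' h (g h) by apply: Rg; rewrite !inE ha.
  case: eqVneq => [->|ca]; case: eqVneq => [->|da] //.
  - by move=> E; have := gb d dX da; rewrite -E eqxx.
  - by move=> E; have := gb c cX' ca; rewrite -E eqxx.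
  - by apply: injg; rewrite !inE ?ca ?da.
case: eqVneq => [->|ca] //.
by have /andP[] : R' c (g c) by apply: Rg; rewrite !inE ca.
Qed.

(* Mendelsohn-Dulmage, by the Schroeder-Bernstein argument: follow [g] on the
   orbits of [f \o g] issued from [Y] outside the image of [f], and [f] elsewhere. *)
Lemma merge_matchings (R : A -> B -> bool) (X : {set A}) (Y : {set B})
    (f : A -> B) (g : B -> A) :
  {in X &, injective f} -> {in X, forall a, R a (f a)} ->
  {in Y &, injective g} -> {in Y, forall b, g b \in X /\ R (g b) b} ->
  exists h : A -> B, [/\ {in X &, injective h}, {in X, forall a, R a (h a)} &
    {in Y, forall b, exists2 a, a \in X & h a = b}].
Proof.
move=> injf Rf injg Rg.
pose next b c := (c == f (g b)) && (c \in Y).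
pose Z := [set b in Y | [exists b1 in Y, (b1 \notin f @: X) && connect next b1 b]].
have sZY b : b \in Z -> b \in Y by rewrite inE => /andP[].
have Znext b : b \in Z -> f (g b) \in Y -> f (g b) \in Z.
  rewrite !inE => /andP[bY /exists_inP[b1 b1Y /andP[b1f cb]]] fY; rewrite fY /=.
  apply/exists_inP; exists b1 => //; rewrite b1f /=.
  by apply: connect_trans cb (connect1 _); rewrite /next eqxx.
(* An orbit starts outside the image of [f], so a point of [Z] inside this image has a predecessor
   on its orbit. *)
have Zpred b : b \in Z -> b \in f @: X -> exists2 c, c \in Z & b = f (g c).
  rewrite inE => /andP[bY /exists_inP[b1 b1Y /andP[b1f /connectP[p]]]].
  elim/last_ind: p => [|p c _]; first by move=> _ /= ->; rewrite (negPf b1f).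
  rewrite rcons_path last_rcons => /andP[pp /andP[/eqP lastE cY]] bE _.
  exists (last b1 p); last by rewrite bE.
  have lY : last b1 p \in Y.
    case/lastP: p pp {lastE} => [//|p d]; rewrite rcons_path last_rcons.
    by case/andP=> _ /andP[].
  rewrite inE lY; apply/exists_inP; exists b1 => //; rewrite b1f.
  by apply/connectP; exists p.
pose h a := if [pick b in Z | g b == a] is Some b then b else f a.
have hZ b : b \in Z -> h (g b) = b.
  rewrite /h => bZ; case: pickP => [c /andP[cZ /eqP]|/(_ b)]; last by rewrite bZ eqxx.
  by apply: injg; apply: sZY.
have hP a : (exists2 b, b \in Z & a = g b /\ h a = b) \/
            (forall b, b \in Z -> g b <> a) /\ h a = f a.
  rewrite /h; case: pickP => [c /andP[cZ /eqP E]|noZ]; first by left; exists c.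
  by right; split=> // b bZ /eqP E; have := noZ b; rewrite bZ E.
have fnotZ a b : a \in X -> (forall c, c \in Z -> g c <> a) -> b \in Z -> f a <> b.
  move=> aX noZ bZ E; have [|c cZ bE] := Zpred b bZ.
    by rewrite -E imset_f.
  apply: (noZ c cZ); apply: injf => //; last by rewrite E.
  by case: (Rg c (sZY _ cZ)).
exists h; split=> [a a' aX a'X|a aX|b bY].
- case: (hP a) => [[b bZ [-> ->]]|[na ->]]; case: (hP a') => [[b' bZ' [-> ->]]|[na' ->]].
  + by move=> ->.
  + by move=> E; case: (fnotZ a' b a'X na' bZ).
  + by move=> E; case: (fnotZ a b' aX na bZ').
  + exact: injf.
- case: (hP a) => [[b bZ [-> ->]]|[na ->]]; last exact: Rf.
  by case: (Rg b (sZY _ bZ)).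
have [bZ|bnZ] := boolP (b \in Z).
  by exists (g b); [case: (Rg b bY) | apply: hZ].
have /imsetP[a aX bE] : b \in f @: X.
  apply: contraR bnZ => nb; rewrite inE bY; apply/exists_inP; exists b => //.
  by rewrite nb connect0.
(* If [a] were [g c] with [c] in [Z], then [b = f (g c)] would itself lie in [Z]. *)
exists a => //; case: (hP a) => [[c cZ [ag hc]]|[_ ->]] //.
by move: bnZ; rewrite bE ag Znext // -ag -bE.
Qed.

End Hall.

(** * Induction over disjoint unions *)

Section DisjointUnion.
Variables (I T : finType) (Q : {set T} -> Prop).
Hypothesis Q0 : Q set0.
Hypothesis QU : forall A B : {set T}, [disjoint A & B] -> Q A -> Q B -> Q (A :|: B).

(** Serves for perfect matchings, with blocks indexed by [S], and for induced path decompositions,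
    with blocks indexed by parts. *)
Lemma bigcup_disjoint_ind (P : {set I}) (F : I -> {set T}) :
  {in P &, forall C D, C != D -> [disjoint F C & F D]} ->
  {in P, forall C, Q (F C)} -> Q (\bigcup_(C in P) F C).
Proof.
have [n] := ubnP #|P|; elim: n P => // n IH P /ltnSE leP disF QF.
have [->|[C CP]] := set_0Vmem P; first by rewrite big_set0.
have cP := cardsD1 C P; rewrite CP in cP.
rewrite (big_setD1 C) //=; apply: QU; last 2 first.
- exact: QF.
- apply: IH => [|D E|D]; first lia.
    by rewrite !inE => /andP[_ ?] /andP[_ ?]; apply: disF.
  by rewrite inE => /andP[_ ?]; apply: QF.
apply: bigcup_disjoint => D; rewrite !inE => /andP[DC DP].
by apply: disF => //; rewrite eq_sym.
Qed.

End DisjointUnion.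

Lemma odd_sum_odd_cards (T : finType) (P : {set {set T}}) :
  {in P, forall C : {set T}, odd #|C|} -> odd (\sum_(C in P) #|C|) = odd #|P|.
Proof.
move=> oP; rewrite -sum1_card; elim/big_rec2: _ => // C m n CP IH.
by rewrite !oddD IH oP.
Qed.

(** * Perfect matchings of vertex sets *)

Section Matching.
Variables (T : finType) (e : rel T).
Hypotheses (e_sym : symmetric e) (e_irr : irreflexive e).

(** A perfect matching of the subgraph induced on [U], encoded as an involution sending each vertex
    to a neighbour; finite functions keep the predicate Boolean. *)
Definition pm (U : {set T}) : bool :=
  [exists f : {ffun T -> T},
    [forall x in U, [&& f x \in U, e x (f x) & f (f x) == x]]].

Lemma pmP (U : {set T}) :
  reflect (exists f : T -> T, forall x, x \in U -> [/\ f x \in U, e x (f x) & f (f x) = x])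
    (pm U).
Proof.
apply: (iffP existsP) => [[f /forall_inP fP]|[f fP]].
  by exists f => x /fP /and3P[? ? /eqP].
exists [ffun x => f x]; apply/forall_inP => x /fP[fU ex fx].
by rewrite !ffunE fU ex fx eqxx.
Qed.

Lemma pm0 : pm set0.
Proof. by apply/pmP; exists id => x; rewrite inE. Qed.

Lemma pmU (A B : {set T}) : [disjoint A & B] -> pm A -> pm B -> pm (A :|: B).
Proof.
move=> dAB /pmP[f fP] /pmP[g gP].
apply/pmP; exists (fun x => if x \in A then f x else g x) => x; rewrite inE.
case: ifPn => [xA _|xA /= xB].
  by have [fA ex fx] := fP x xA; rewrite inE fA.
have [gB ex gx] := gP x xB; rewrite inE gB orbT ex gx; split=> //.
by rewrite (disjointFl dAB gB).
Qed.

Lemma edge_neq x y : e x y -> x != y.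
Proof. by apply: contraTneq => ->; rewrite e_irr. Qed.

Lemma pm_edge x y : e x y -> pm [set x; y].
Proof.
move=> exy; have nxy := edge_neq exy.
apply/pmP; exists (fun z => if z == x then y else x) => z.
have yx : (y == x) = false by rewrite eq_sym (negPf nxy).
by rewrite !inE => /orP[]/eqP->; rewrite ?eqxx yx ?eqxx ?orbT // e_sym.
Qed.

Lemma pm_add x y (U : {set T}) :
  x \in U -> y \in U -> e x y -> pm (U :\: [set x; y]) -> pm U.
Proof.
move=> xU yU exy pU; have -> : U = [set x; y] :|: (U :\: [set x; y]).
  by set_ext.
apply: pmU => //; last exact: pm_edge.
by rewrite -setI_eq0; apply/eqP; set_ext.
Qed.

Lemma pm_partner (U : {set T}) x :
  pm U -> x \in U -> exists y, [/\ y \in U, e x y & pm (U :\: [set x; y])].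
Proof.
move=> /pmP[f fP] xU; have [fxU exf ffx] := fP x xU.
exists (f x); split=> //; apply/pmP; exists f => z.
rewrite !inE negb_or => /andP[/andP[zx zf] /fP[fz ez ffz]].
rewrite fz ez ffz; split=> //; rewrite andbT negb_or.
by apply/andP; split; apply/eqP => E; [move: zf | move: zx];
  rewrite -ffz E ?ffx eqxx.
Qed.

Lemma pm_even (U : {set T}) : pm U -> ~~ odd #|U|.
Proof.
have [n] := ubnP #|U|; elim: n U => // n IH U /ltnSE leU pU.
have [->|[x xU]] := set_0Vmem U; first by rewrite cards0.
have [y [yU exy pUxy]] := pm_partner pU xU.
have := cardsD U [set x; y].
have -> : U :&: [set x; y] = [set x; y] by set_ext.
rewrite cards2 (edge_neq exy) => cU.
have ge2 : 1 < #|U|.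
  rewrite (leq_trans _ (subset_leq_card (_ : [set x; y] \subset U))) //.
    by rewrite cards2 (edge_neq exy).
  by rewrite subUset !sub1set xU.
have := IH _ _ pUxy; rewrite cU; lia.
Qed.

(** No edge of [U] leaves [K], so partners of vertices of [K] stay in [K]. *)
Lemma pm_restrict (U K : {set T}) :
  K \subset U -> {in K & U, forall x y, e x y -> y \in K} -> pm U -> pm K.
Proof.
move=> /subsetP sKU clK /pmP[f fP]; apply/pmP; exists f => x xK.
by have [fU ex fx] := fP x (sKU x xK); rewrite ex fx (clK x).
Qed.

(** * Barriers and a decomposition of Gallai-Edmonds type *)

Definition factor_critical (C : {set T}) := {in C, forall v, pm (C :\ v)}.

Lemma factor_critical_odd (C : {set T}) : C != set0 -> factor_critical C -> odd #|C|.
Proof.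
case/set0Pn=> v vC fc; have := pm_even (fc v vC).
by rewrite (cardsD1 v C) vC oddD => /negbTE ->.
Qed.

Definition adj_set (C : {set T}) (s : T) := [exists c in C, e s c].

(** The pair is a set [S] with a family [P] of disjoint odd sets attached to the rest of [U] only
    through [S]. The members of [P] may be disconnected and may leave vertices uncovered, which
    makes modified barriers easy to write down. *)
Definition barrier (U : {set T}) (X : {set T} * {set {set T}}) : bool :=
  [&& X.1 \subset U, trivIset X.2, cover X.2 \subset U :\: X.1,
      [forall C in X.2, odd #|C|] &
      [forall C in X.2, forall x in C, forall y in U, e x y ==> (y \in C :|: X.1)]].

Lemma barrierP (U S : {set T}) (P : {set {set T}}) :
  reflect [/\ S \subset U, trivIset P, {in P, forall C : {set T}, C \subset U :\: S},
              {in P, forall C : {set T}, odd #|C|} &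
              {in P, forall C : {set T}, {in C & U, forall x y, e x y -> y \in C :|: S}}]
    (barrier U (S, P)).
Proof.
apply: (iffP and5P) => -[/= sSU tP cP oP nP]; split=> //.
- by move=> C CP; apply: subset_trans cP; apply: bigcup_sup CP.
- by move=> C CP; apply: (forall_inP oP).
- move=> C CP x y xC yU exy.
  by move/forall_inP/(_ C CP)/forall_inP/(_ x xC)/forall_inP/(_ y yU)/implyP: nP; apply.
- by apply/bigcupsP.
- exact/forall_inP.
- apply/forall_inP => C CP; apply/forall_inP => x xC; apply/forall_inP => y yU.
  by apply/implyP; apply: nP.
Qed.

Lemma ex_max_barrier U : exists S P,
  barrier U (S, P) /\ forall S' P', barrier U (S', P') ->
    #|P'| + #|S| <= #|P| + #|S'| /\
    (#|P'| + #|S| = #|P| + #|S'| -> #|S'| <= #|S|).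
Proof.
(* Lexicographic weight: adding [#|T|] keeps the subtraction exact, and the factor [#|T|.+1] exceeds
   every [#|S|]. *)
pose w (X : {set T} * {set {set T}}) :=
  (#|X.2| + #|T| - #|X.1|) * #|T|.+1 + #|X.1|.
have b0 : barrier U (set0, set0).
  apply/barrierP; split; rewrite ?sub0set //; try by move=> C; rewrite inE.
  by apply/trivIsetP => C D; rewrite inE.
case: (@arg_maxnP _ (set0, set0) (barrier U) w b0) => -[S P] bSP maxSP.
exists S, P; split=> // S' P' /maxSP; rewrite /w /=.
have := max_card (mem S); have := max_card (mem S').
move: #|S| #|S'| #|P| #|P'| #|T| => a a' p p' t lea' lea; split; nia.
Qed.

Lemma cards_cover (P : {set {set T}}) U : trivIset P -> cover P = U ->
  #|U| = \sum_(C in P) #|C|.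
Proof. by rewrite /trivIset => /eqP-> ->. Qed.

(* Maximality of [#|P| - #|S|] makes the complement of [S] covered, since an odd
   remainder is a new part, and an even one becomes odd by moving a vertex to [S]. *)
Lemma max_barrier_cover U S P : barrier U (S, P) ->
  (forall S' P', barrier U (S', P') ->
    #|P'| + #|S| <= #|P| + #|S'| /\
    (#|P'| + #|S| = #|P| + #|S'| -> #|S'| <= #|S|)) ->
  cover P = U :\: S.
Proof.
move=> /barrierP[sSU tP sP oP nP] maxSP.
apply/eqP; rewrite eqEsubset; apply/andP; split; first exact/bigcupsP.
rewrite -setD_eq0; set R := _ :\: cover P.
have sRU : R \subset U :\: S by apply: subsetDl.
have nR : {in R & U, forall x y, e x y -> y \in R :|: S}.
  move=> x y; rewrite !inE => /and3P[xP xS xU] yU exy; rewrite yU andbT.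
  have [//|yS] := boolP (y \in S); first by rewrite orbT.
  rewrite orbF andbT; apply: contra xP => /bigcupP[C CP yC].
  have := nP C CP y x yC xU; rewrite e_sym exy inE (negPf xS) orbF => /(_ isT) xC.
  by apply/bigcupP; exists C.
have dR C : C \in P -> [disjoint C & R].
  move=> CP; rewrite disjoint_sym; apply/pred0P => z /=; rewrite !inE.
  apply/negP => /andP[/andP[zP _] zC]; case/negP: zP; apply/bigcupP; by exists C.
have notP (R' : {set T}) : odd #|R'| -> R' \subset R -> R' \notin P.
  move=> oR sR'; apply/negP => /dR d; have := disjointWr sR' d.
  rewrite -setI_eq0 setIid => /eqP E; by rewrite E cards0 in oR.
(* Both parities adjoin an odd subset [R'] of the remainder as a new part, with [S'] equal to [S] or
   to [S] plus one vertex. *)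
have add (R' S' : {set T}) : odd #|R'| -> R' \subset R -> S' \subset U ->
    S \subset S' -> [disjoint R' & S'] -> (forall C, C \in P -> [disjoint C & S']) ->
    {in R' & U, forall x y, e x y -> y \in R' :|: S'} -> barrier U (S', R' |: P).
  move=> oR sR' sS'U sSS' dR'S' dP nR'; apply/barrierP; split=> //.
  - have dP' : {in P, forall C : {set T}, [disjoint R' & C]}.
      by move=> C CP; rewrite disjoint_sym; apply: disjointWr sR' (dR C CP).
    have P0 : set0 \notin P by apply/negP => /oP; rewrite cards0.
    by have [] := trivIsetU1 dP' tP P0.
  - move=> C; rewrite in_setU1 => /predU1P[->|CP]; rewrite subsetD.
      rewrite dR'S' andbT; apply: subset_trans sR' (subset_trans sRU _).
      exact: subsetDl.
    rewrite dP // andbT; apply: subset_trans (sP C CP) _; exact: subsetDl.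
  - by move=> C; rewrite in_setU1 => /predU1P[->|/oP].
  - move=> C; rewrite in_setU1 => /predU1P[->|CP] // x y xC yU exy.
    have := nP C CP x y xC yU exy; rewrite !inE => /orP[->//|/(subsetP sSS') ->].
    by rewrite orbT.
have dRS : [disjoint R & S].
  by move: sRU; rewrite subsetD => /andP[].
have dPS C : C \in P -> [disjoint C & S].
  by move=> /sP; rewrite subsetD => /andP[].
have [oR|eR] := boolP (odd #|R|).
  have bR : barrier U (S, R |: P) by apply: add.
  by have [] := maxSP _ _ bR; rewrite cardsU1 notP //; lia.
have [//|[v vR]] := set_0Vmem R; first by move=> ->.
have cR := cardsD1 v R; rewrite vR in cR.
have vS : v \notin S by rewrite (disjointFr dRS vR).
have vU : v \in U by move: vR; rewrite !inE => /and3P[].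
have oR' : odd #|R :\ v| by rewrite cR /= in eR; rewrite negbK in eR.
(* Here [#|P|] and [#|S|] both grow by one, which the tie-break on [#|S|] forbids. *)
have bR : barrier U (v |: S, (R :\ v) |: P).
  apply: add => //; rewrite ?subD1set ?subsetU1 ?subUset ?sub1set ?vU //.
  - rewrite -setI_eq0; apply/eqP/setP=> z; rewrite !inE; case: eqP => //= _.
    have [zS|] := boolP (z \in S); last by rewrite andbF.
    by rewrite !andbT andbF.
  - move=> C CP; apply/pred0P=> z /=; rewrite in_setU1 andb_orr.
    case: eqP => [->|_]; rewrite ?andbT ?andbF /=.
      by rewrite (disjointFl (dR C CP) vR).
    by have /pred0P/(_ z) := dPS C CP.
  - move=> x y xR yU exy; have xR' : x \in R by move: xR; rewrite inE => /andP[].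
    have := nR x y xR' yU exy; rewrite !in_setU in_setD1 in_set1.
    by case: eqP.
have [] := maxSP _ _ bR; rewrite !cardsU1 notP ?subD1set // vS /=.
by move: #|P| #|S| => p s; clear; lia.
Qed.

(** If [X] violated Hall's condition, deleting [X] from [S] and the parts adjacent to it from [P]
    would give a barrier with larger [#|P| - #|S|]. *)
Lemma max_barrier_matching U S P : barrier U (S, P) ->
  (forall S' P', barrier U (S', P') -> #|P'| + #|S| <= #|P| + #|S'|) ->
  exists f : T -> {set T}, {in S &, injective f} /\
    {in S, forall s, (f s \in P) && adj_set (f s) s}.
Proof.
move=> /barrierP[sSU tP sP oP nP] maxSP.
pose R s C := (C \in P) && adj_set C s.
apply: (hall_marriage set0 (R := R)) => X sXS.
rewrite leqNgt; apply/negP => ltX.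
have sNP : nbhd R X \subset P by apply/subsetP => C /nbhdP[s _ /andP[]].
have b : barrier U (S :\: X, P :\: nbhd R X).
  apply/barrierP; split.
  - exact: subset_trans (subsetDl _ _) sSU.
  - by apply: trivIsetS tP; apply: subsetDl.
  - move=> C; rewrite inE => /andP[_ CP]; apply: subset_trans (sP C CP) _.
    by apply: setDS; apply: subsetDl.
  - by move=> C; rewrite inE => /andP[_ /oP].
  - move=> C; rewrite in_setD => /andP[CN CP] x y xC yU exy.
    have := nP C CP x y xC yU exy; rewrite !in_setU in_setD => /orP[->//|yS].
    rewrite yS andbT; apply/orP; right; apply: contra CN => yX.
    apply/nbhdP; exists y => //; rewrite /R CP; apply/exists_inP; exists x => //.
    by rewrite e_sym.
have := maxSP _ _ b; rewrite !cardsD (setIidPr sXS) (setIidPr sNP).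
have := subset_leq_card sXS; have := subset_leq_card sNP; move: ltX.
move: #|S| #|P| #|X| #|nbhd R X| => s p x m; clear; lia.
Qed.

(** By counting, [f] maps [S] bijectively onto [P]; each [s] is matched to a neighbour in [f s], and
    the rest of [f s] by factor-criticality. *)
Lemma pm_of_matched_parts (U S : {set T}) (P : {set {set T}}) (f : T -> {set T}) :
  S \subset U -> trivIset P -> cover P = U :\: S ->
  {in P, forall C, factor_critical C} ->
  {in S &, injective f} -> {in S, forall s, (f s \in P) && adj_set (f s) s} ->
  #|P| <= #|S| -> pm U.
Proof.
move=> sSU tP cP fcP injf fP leP.
have fS : f @: S = P.
  apply/eqP; rewrite eqEcard card_in_imset // leP andbT.
  by apply/subsetP=> C /imsetP[s /fP /andP[? _] ->].
have fsS s z : s \in S -> z \in f s -> z \notin S.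
  move=> sS zf; have /andP[fsP _] := fP s sS.
  have : z \in cover P by apply/bigcupP; exists (f s).
  by rewrite cP inE => /andP[].
have -> : U = \bigcup_(s in S) (s |: f s).
  apply/setP=> z; apply/idP/bigcupP => [zU|[s sS]].
    have [zS|zS] := boolP (z \in S); first by exists z => //; rewrite setU11.
    have: z \in cover P by rewrite cP inE zS.
    case/bigcupP=> C; rewrite -fS => /imsetP[s sS ->] zf.
    by exists s => //; rewrite inE zf orbT.
  rewrite in_setU1 => /predU1P[->|zf]; first exact: (subsetP sSU).
  have /andP[fsP _] := fP s sS.
  have : z \in cover P by apply/bigcupP; exists (f s).
  by rewrite cP inE => /andP[].
apply: (bigcup_disjoint_ind (Q := fun A => pm A)) => [||s t sS tS st|s sS].
- exact: pm0.
- by move=> A B; apply: pmU.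
- have /andP[fsP _] := fP s sS; have /andP[ftP _] := fP t tS.
  have fst : f s != f t by apply: contraNneq st => /injf->.
  have dst : [disjoint f s & f t] by apply: (trivIsetP tP).
  apply/pred0P => z /=; rewrite !in_setU1; apply/negP => /andP[].
  case/predU1P=> [->|zs]; case/predU1P=> [E|zt].
  + by rewrite E eqxx in st.
  + by have := fsS t s tS zt; rewrite sS.
  + by have := fsS s z sS zs; rewrite E tS.
  + by rewrite (disjointFr dst zs) in zt.
have /andP[fsP /exists_inP[c cf esc]] := fP s sS.
apply: (pm_add (x := s) (y := c)); rewrite ?setU11 // ?inE ?cf ?orbT //.
have -> : (s |: f s) :\: [set s; c] = f s :\ c; last exact: fcP.
have sf : s \notin f s by apply/negP => /(fsS s s sS); rewrite sS.
by set_ext.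
Qed.

Record gallai_edmonds (U S : {set T}) (P : {set {set T}}) (f : T -> {set T}) : Prop :=
  GallaiEdmonds {
    ge_sub : S \subset U;
    ge_triv : trivIset P;
    ge_cover : cover P = U :\: S;
    ge_odd : {in P, forall C : {set T}, odd #|C|};
    ge_nbhd : {in P, forall C : {set T}, {in C & U, forall x y, e x y -> y \in C :|: S}};
    ge_fc : {in P, forall C, factor_critical C};
    ge_inj : {in S &, injective f};
    ge_match : {in S, forall s, (f s \in P) && adj_set (f s) s} }.

(** An optimal barrier works. For factor-criticality, the inductive decomposition of [C :\ c] either
    yields a perfect matching or, inserted in place of [C], contradicts optimality. *)
Lemma gallai_edmonds_exists U : exists S P f, gallai_edmonds U S P f.
Proof.
have [n] := ubnP #|U|; elim: n U => // n IH U /ltnSE leU.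
have [S [P [bSP maxSP]]] := ex_max_barrier U.
have [|f [injf fP]] := max_barrier_matching bSP.
  by move=> S' P' /maxSP[].
have cP := max_barrier_cover bSP maxSP.
have /barrierP[sSU tP sP oP nP] := bSP.
exists S, P, f; split=> // C CP c cC.
have sCU : C \subset U := subset_trans (sP C CP) (subsetDl _ _).
have cC1 := cardsD1 c C; rewrite cC in cC1.
have leC := subset_leq_card sCU.
have [|S' [P' [f' ge']]] := IH (C :\ c); first by lia.
have [sS' tP' cP' oP' nP' fc' injf' fP'] := ge'.
have [le|gt] := leqP #|P'| #|S'|; first exact: (pm_of_matched_parts sS' tP' cP' fc' injf' fP').
exfalso.
have cS' : c \notin S' by apply/negP => /(subsetP sS'); rewrite !inE eqxx.
have sS'C : S' \subset C := subset_trans sS' (subD1set _ _).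
(* [#|C :\ c|] is even, so [#|P'|] and [#|S'|] have equal parity and a positive excess is at least
   two. *)
have par : #|P'| >= #|S'|.+2.
  have := cardsD (C :\ c) S'; rewrite (setIidPr sS') (cards_cover tP' cP').
  have := odd_sum_odd_cards oP'; have := oP C CP; have := subset_leq_card sS'; move: cC1 gt.
  by move: #|C| #|C :\ c| #|S'| #|P'| (\sum_(D in P') #|D|) => a b d g h; clear; lia.
have dCS : [disjoint C & S] by move: (sP C CP); rewrite subsetD => /andP[].
have dSS' : [disjoint S & c |: S'].
  rewrite disjoint_sym; apply: disjointWl dCS.
  by rewrite subUset sub1set cC.
have sP'C D : D \in P' -> D \subset C :\ c :\: S'.
  by move=> DP; rewrite -cP'; apply: bigcup_sup DP.
have n0 D : D \in P' -> D != set0.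
  by move/oP'; apply: contraTneq => ->; rewrite cards0.
have dCD D : D \in P -> D != C -> [disjoint C & D].
  by move=> DP DC; apply: (trivIsetP tP); rewrite // eq_sym.
have dPP : [disjoint P :\ C & P'].
  apply/pred0P=> D /=; rewrite !inE; apply/negP => /andP[/andP[DC DP] DP'].
  have sDC : D \subset C.
    by apply: subset_trans (sP'C D DP') _; rewrite setDDl subsetDl.
  have := disjointWl sDC (dCD D DP DC); rewrite -setI_eq0 setIid.
  by rewrite (negPf (n0 D DP')).
(* The excess of two pays for losing [C] from [P] and adding [c] to [S]: the difference does not
   drop, while [#|S|] grows. *)
have b : barrier U (S :|: (c |: S'), (P :\ C) :|: P').
  apply/barrierP; split.
  - rewrite !subUset sSU sub1set (subsetP sCU) //=; exact: subset_trans sCU.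
  - apply/trivIsetP => D E; rewrite !inE.
    have dis X Y : (X != C) && (X \in P) -> Y \in P' -> [disjoint X & Y].
      case/andP=> XC XP YP'; rewrite disjoint_sym; apply: disjointWl (dCD X XP XC).
      by apply: subset_trans (sP'C Y YP') _; rewrite setDDl subsetDl.
    case/orP=> [DP|DP']; case/orP=> [EP|EP'] DE.
    + by case/andP: DP => _ DP; case/andP: EP => _ EP; apply: (trivIsetP tP).
    + exact: dis.
    + by rewrite disjoint_sym; apply: dis.
    + exact: (trivIsetP tP').
  - move=> D; rewrite in_setU in_setD1 => /orP[/andP[DC DP]|DP'].
      have := sP D DP; rewrite !subsetD => /andP[-> dDS] /=.
      rewrite disjoint_sym; apply/pred0P=> z /=; apply/negP => /andP[zS zD].
      move: zS; rewrite in_setU (disjointFr dDS zD) /= => zS.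
      have zC : z \in C.
        by move: zS; rewrite in_setU1 => /predU1P[->|/(subsetP sS'C)].
      by rewrite (disjointFr (dCD D DP DC) zC) in zD.
    have := sP'C D DP'; rewrite setDDl !subsetD => /andP[DsC dD].
    by rewrite (subset_trans DsC sCU) /= -setI_eq0 setIUr setU_eq0 !setI_eq0
      (disjointWl DsC dCS) dD.
  - by move=> D; rewrite in_setU in_setD1 => /orP[/andP[_ /oP]|/oP'].
  - move=> D; rewrite in_setU in_setD1 => /orP[/andP[DC DP]|DP'] x y xD yU exy.
      have := nP D DP x y xD yU exy; rewrite !in_setU => /orP[->//|->].
      by rewrite orbT.
    have := sP'C D DP'; rewrite setDDl subsetD => /andP[DsC dD].
    have := nP C CP x y (subsetP DsC x xD) yU exy.
    rewrite !in_setU in_set1 => /orP[yC|->]; last by rewrite orbT.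
    have [->|yc] := eqVneq y c; first by rewrite !orbT.
    have := nP' D DP' x y xD _ exy; rewrite !inE yc yC => /(_ isT) /orP[]->;
      by rewrite ?orbT.
have [] := maxSP _ _ b.
have cC2 := cardsD1 C P; rewrite CP in cC2.
rewrite !cardsU ?(disjoint_setI0 dPP) !(disjoint_setI0 dSS') cards0 !subn0 cards1.
have -> : [set c] :&: S' = set0 by apply/eqP; rewrite setI_eq0 disjoints1.
rewrite cards0 subn0; move: cC2 par; clear.
by move: #|P| #|P :\ C| #|S| #|S'| #|P'| => a b d g h; lia.
Qed.

(** * Rigid parts and their cut vertices *)

Definition rigid (C : {set T}) : bool :=
  [forall x in C, forall y in C, forall z in C,
     [&& e x y, e y z, x != z & pm (C :\: [set x; y; z])] ==> e x z].

Lemma rigidP (C : {set T}) :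
  reflect (forall x y z, x \in C -> y \in C -> z \in C -> e x y -> e y z -> x != z ->
             pm (C :\: [set x; y; z]) -> e x z)
    (rigid C).
Proof.
apply: (iffP forall_inP) => [H x y z xC yC zC exy eyz xz p|H x xC].
  move/(_ x xC)/forall_inP/(_ y yC)/forall_inP/(_ z zC)/implyP: H; apply.
  exact/and4P.
apply/forall_inP => y yC; apply/forall_inP => z zC; apply/implyP => /and4P[].
exact: H.
Qed.

(** Let [y] be the partner of [w']. Removing the path [w w' y] leaves a perfect matching that uses
    [u v], so rigidity makes [w y] an edge; trading [w' y] for [w y] moves the hole. *)
Lemma rigid_move_hole (C : {set T}) u v w w' :
  rigid C -> u \in C -> v \in C -> w \in C -> w' \in C ->
  e u v -> e w w' -> w != u -> w != v -> w' != u -> w' != v ->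
  pm (C :\: [set u; v; w]) -> pm (C :\: [set u; v; w']).
Proof.
move=> /rigidP rC uC vC wC w'C euv eww' wu wv w'u w'v pD.
have w'w : w' != w by rewrite eq_sym edge_neq.
have w'D : w' \in C :\: [set u; v; w] by rewrite !inE !negb_or w'u w'v w'w.
have [y [yD ew'y pDy]] := pm_partner pD w'D.
move: yD; rewrite !inE !negb_or => /andP[/andP[/andP[yu yv] yw] yC].
have yw' : y != w' by rewrite eq_sym edge_neq.
have ewy : e w y.
  apply: (rC w w' y) => //; first by rewrite eq_sym.
  apply: (pm_add (x := u) (y := v)) => //.
  - by rewrite !inE !negb_or uC andbT (eq_sym u w) (eq_sym u w') (eq_sym u y) wu w'u yu.
  - by rewrite !inE !negb_or vC andbT (eq_sym v w) (eq_sym v w') (eq_sym v y) wv w'v yv.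
  by move: pDy; rewrite !setDDl; congr (pm (C :\: _)); set_bool.
apply: (pm_add (x := w) (y := y)) => //.
- by rewrite !inE !negb_or wC andbT wu wv eq_sym.
- by rewrite !inE !negb_or yC andbT yu yv.
by move: pDy; rewrite !setDDl; congr (pm (C :\: _)); set_bool.
Qed.

(* [K] is the set of positions reachable by a hole that starts at [x], travels in
   [C :\ v], and keeps [v] matched to [x'] or to [x]. *)
Lemma rigid_cut (C : {set T}) v x z :
  factor_critical C -> rigid C -> v \in C -> x \in C -> z \in C ->
  e v x -> e v z -> x != z -> ~~ e x z ->
  exists K : {set T}, [/\ K \subset C :\ v, x \in K, z \notin K &
    {in K & C :\ v, forall w w', e w w' -> w' \in K}].
Proof.
move=> fcC rC vC xC zC evx evz xz nexz.
have Hrigid := rigidP _ rC.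
have vx := edge_neq evx; have vz := edge_neq evz.
have exv : e x v by rewrite e_sym.
have xCv : x \in C :\ v by rewrite !inE eq_sym vx.
(* [x'] is the partner of [x] in a perfect matching of [C :\ v]; rigidity on the path [x' x v] makes
   it a second possible partner of [v]. *)
have [x' [x'C exx' p0]] := pm_partner (fcC v vC) xCv.
move: x'C; rewrite in_setD1 => /andP[x'v x'C].
have xx' := edge_neq exx'.
have ex'x : e x' x by rewrite e_sym.
have ex'v : e x' v.
  apply: (Hrigid x' x v) => //.
  by move: p0; rewrite !setDDl; congr (pm (C :\: _)); set_bool.
pose K := [set w in C :\ v | (w != x') && pm (C :\: [set x'; v; w])
                          || (w != x) && pm (C :\: [set x; v; w])].
exists K; split.
- by apply/subsetP => w; rewrite inE => /andP[].
- rewrite inE xCv xx' /=; apply/orP; left.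
  by move: p0; rewrite !setDDl; congr (pm (C :\: _)); set_bool.
(* A hole at [z] with [v] matched to [x] gives the edge [x z] by rigidity on [x v z]. With [v]
   matched to [x'], the partner [z'] of [z] turns out adjacent to [v], and a matching through [z' v]
   avoids exactly the path [x x' z], giving the same edge. *)
- rewrite inE negb_and; apply/orP; right; apply/negP => /orP[]/andP[zx' pz]; last first.
    by case/negP: nexz; apply: (Hrigid x v z).
  have ex'z : e x' z by apply: (Hrigid x' v z) => //; rewrite eq_sym.
  have zD : z \in C :\ v :\: [set x; x'].
    by rewrite !inE negb_or zC andbT (eq_sym z x) xz zx' eq_sym.
  have [z' [z'D ezz' p1]] := pm_partner p0 zD.
  move: z'D; rewrite !inE negb_or => /andP[/andP[z'x z'x'] /andP[z'v z'C]].
  have zz' := edge_neq ezz'.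
  have ez'z : e z' z by rewrite e_sym.
  have ez'v : e z' v.
    apply: (Hrigid z' z v) => //; first by rewrite e_sym.
    apply: (pm_add (x := x) (y := x')) => //.
    + by rewrite !inE !negb_or xC andbT (eq_sym x z') z'x xz (eq_sym x v) vx.
    + by rewrite !inE !negb_or x'C andbT (eq_sym x' z') z'x' eq_sym zx' x'v.
    by move: p1; rewrite !setDDl; congr (pm (C :\: _)); set_bool.
  case/negP: nexz; apply: (Hrigid x x' z) => //.
  apply: (pm_add (x := z') (y := v)) => //.
  + by rewrite !inE !negb_or z'C andbT z'x z'x' eq_sym.
  + by rewrite !inE !negb_or vC andbT vx (eq_sym v x') x'v vz.
  by move: p1; rewrite !setDDl; congr (pm (C :\: _)); set_bool.
move=> w w'; rewrite !inE => /andP[/andP[wv wC] Hw] /andP[w'v w'C] eww'.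
rewrite w'v w'C /=; case/orP: Hw => /andP[wx pw].
(* When the hole would enter the current partner of [v], [p0] switches that partner between [x'] and
   [x]. *)
- have [->|w'x'] := eqVneq w' x'.
    rewrite (eq_sym x' x) xx' /=.
    by move: p0; rewrite !setDDl; congr (pm (C :\: _)); set_bool.
  by apply/orP; left; apply: (rigid_move_hole rC) pw.
- have [->|w'x] := eqVneq w' x.
    rewrite xx' /= orbF.
    by move: p0; rewrite !setDDl; congr (pm (C :\: _)); set_bool.
  by apply/orP; right; apply: (rigid_move_hole rC) pw.
Qed.

Lemma closed_setD (D K : {set T}) : K \subset D ->
  {in K & D, forall x y, e x y -> y \in K} ->
  {in D :\: K & D, forall x y, e x y -> y \in D :\: K}.
Proof.
move=> sKD clK x y; rewrite !inE => /andP[xK xD] yD exy; rewrite yD andbT.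
by apply: contra xK => yK; apply: (clK y x) => //; rewrite e_sym.
Qed.

Lemma pm_cut_part (C K : {set T}) v : factor_critical C -> v \in C ->
  K \subset C :\ v -> {in K & C :\ v, forall w w', e w w' -> w' \in K} -> pm K.
Proof. by move=> fcC vC sK clK; apply: pm_restrict (fcC v vC). Qed.

(** For [a] in [K], parity forces the partner of [v] in a perfect matching of [C :\ a] to lie in
    [K], so this matching restricts to [(v |: K) :\ a]. *)
Lemma factor_critical_cut (C K : {set T}) v : factor_critical C -> v \in C ->
  K \subset C :\ v -> {in K & C :\ v, forall w w', e w w' -> w' \in K} ->
  factor_critical (v |: K).
Proof.
move=> fcC vC sK clK a.
have sKC := subset_trans sK (subD1set _ _).
have vK : v \notin K by apply/negP => /(subsetP sK); rewrite !inE eqxx.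
have pK := pm_cut_part fcC vC sK clK.
have pL := pm_cut_part fcC vC (subsetDl _ _) (closed_setD sK clK).
have [-> _|av] := eqVneq a v; first by rewrite setU1K.
rewrite in_setU1 (negPf av) /= => aK.
have aC := subsetP sKC _ aK.
have vCa : v \in C :\ a by rewrite !inE eq_sym av.
have [y [yCa evy py]] := pm_partner (fcC a aC) vCa.
move: yCa; rewrite in_setD1 => /andP[ya yC].
have yv : y != v by rewrite eq_sym edge_neq.
have yCv : y \in C :\ v by rewrite !inE yv.
have yK : y \in K.
  apply: contraT => yK.
  (* Were [y] outside [K], the side outside [K] would be matched both with and without [y], against
     parity. *)
  have: pm ((C :\ v :\: K) :\ y).
    apply: pm_restrict py.
      apply/subsetP => w; rewrite !inE negb_or.
      case/and4P=> wy wK wv wC; rewrite wv wy wC /= andbT.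
      by apply: contraNneq wK => ->.
    move=> w w'; rewrite !inE negb_or => /and4P[wy wK wv wC] /andP[/andP[w'v w'y] /andP[_ w'C]].
    move=> eww'; rewrite w'y w'v w'C !andbT /=; apply: contra wK => w'K.
    by apply: (clK w' w) => //; rewrite ?inE ?wv // e_sym.
  move/pm_even; have := pm_even pL.
  by rewrite (cardsD1 y (C :\ v :\: K)) in_setD yK yCv oddD /= negbK => ->.
apply: (pm_add (x := v) (y := y)) => //.
- by rewrite !inE eqxx eq_sym av.
- by rewrite !inE yK ya orbT.
apply: pm_restrict py.
  apply/subsetP => w; rewrite !inE.
  case/and3P; rewrite negb_or => /andP[wv wy] wa; rewrite (negPf wv) /= => wK.
  by rewrite wy wa (subsetP sKC).
move=> w w'; rewrite !inE !negb_or.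
case/and3P=> /andP[wv wy] wa; rewrite (negPf wv) /= => wK.
case/and3P=> /andP[w'v w'y] w'a w'C eww'.
rewrite (negPf w'v) w'y w'a /=.
by apply: (clK w w'); rewrite // !inE w'v.
Qed.

(** A perfect matching of [C :\ v :\: K] extends one of [(v |: K) :\: [set x; y; z]] to one of [C
    :\: [set x; y; z]]. *)
Lemma rigid_cut_part (C K : {set T}) v : factor_critical C -> rigid C -> v \in C ->
  K \subset C :\ v -> {in K & C :\ v, forall w w', e w w' -> w' \in K} ->
  rigid (v |: K).
Proof.
move=> fcC /rigidP rC vC sK clK.
have sA : v |: K \subset C.
  by rewrite subUset sub1set vC (subset_trans sK (subD1set _ _)).
have pL := pm_cut_part fcC vC (subsetDl _ _) (closed_setD sK clK).
apply/rigidP => x y z xA yA zA exy eyz xz p; apply: (rC x y z) => //;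
  rewrite ?(subsetP sA) //.
have -> : C :\: [set x; y; z] = (v |: K) :\: [set x; y; z] :|: (C :\ v :\: K).
  apply/setP=> w; rewrite !in_setU !in_setD; have [wA|wA] := boolP (w \in v |: K).
    rewrite (subsetP sA) //; move: wA; rewrite in_setU1.
    by case/orP=> [/eqP->|->]; rewrite ?in_set1 ?eqxx ?andbF ?orbF.
  have -> : w \notin [set x; y; z].
    apply: contra wA; rewrite !inE -orbA => /or3P[]/eqP->; rewrite -in_setU1 //.
  by move: wA; rewrite in_setU1 negb_or in_set1 => /andP[-> ->].
apply: pmU => //; apply/pred0P => w /=; rewrite !inE.
by case: (w == v); case: (w \in K); rewrite /= ?andbF.
Qed.

(** * Degree sums of rigid parts *)

Definition deg_in (C : {set T}) v := #|[set w in C | e v w]|.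

Lemma deg_in_cut_part (C K : {set T}) v : v \in C -> K \subset C :\ v ->
  {in K & C :\ v, forall w w', e w w' -> w' \in K} ->
  {in K, forall w, deg_in (v |: K) w = deg_in C w}.
Proof.
move=> vC sK clK w wK; apply: eq_card => u; rewrite !inE.
have [ewu|] := boolP (e w u); rewrite ?andbF // !andbT.
have [->|uv] := eqVneq u v; first by rewrite vC.
apply/idP/idP => [/(subsetP sK)|uC]; first by rewrite inE => /andP[].
by apply: (clK w u); rewrite // !inE uv.
Qed.

Lemma deg_in_cut_vertex (C K : {set T}) v : v \in C -> K \subset C :\ v ->
  deg_in C v = deg_in (v |: K) v + deg_in (v |: (C :\ v :\: K)) v.
Proof.
move=> vC sK; rewrite /deg_in -(cardsID K [set w in C | e v w]); congr (_ + _).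
  apply: eq_card => u; rewrite !inE; have [->|uv] := eqVneq u v.
    by rewrite e_irr !andbF.
  rewrite andbC andbA; congr (_ && _); apply/andP/idP => [[]//|uK]; split=> //.
  by have := subsetP sK u uK; rewrite inE => /andP[].
apply: eq_card => u; rewrite !inE; have [->|uv] := eqVneq u v.
  by rewrite e_irr !andbF.
by rewrite andbA.
Qed.

Lemma deg_in_gt0 (C : {set T}) v w : w \in C -> e v w -> 0 < deg_in C v.
Proof. by move=> wC evw; apply/card_gt0P; exists w; rewrite inE wC. Qed.

Lemma complete_deg_in (C : {set T}) v :
  {in C &, forall x y, x != y -> e x y} -> v \in C -> (deg_in C v).+1 = #|C|.
Proof.
move=> cC vC; rewrite (cardsD1 v C) vC; congr _.+1; apply: eq_card => w.
rewrite !inE andbC; have [wC|] := boolP (w \in C); rewrite ?andbF // !andbT.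
by have [->|wv] := eqVneq w v; [rewrite e_irr | rewrite cC // eq_sym].
Qed.

(** Otherwise no edge inside [C] leaves the closed neighbourhood [K] of [a]. Matchings of [C :\ b]
    and [C :\ a] then restrict to [K] and [K :\ a], against parity. *)
Lemma factor_critical_not_complete (C : {set T}) a b : factor_critical C ->
  a \in C -> b \in C -> a != b -> ~~ e a b ->
  exists v x z, [/\ v \in C, x \in C & z \in C] /\ [/\ e v x, e v z, x != z & ~~ e x z].
Proof.
move=> fcC aC bC ab neab.
have [/existsP[v /existsP[x /existsP[z /and3P[/and3P[? ? ?] ? /and3P[? ? ?]]]]]|noP3] :=
  boolP [exists v, exists x, exists z,
    [&& [&& v \in C, x \in C & z \in C], e v x & [&& e v z, x != z & ~~ e x z]]].
  by exists v, x, z.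
have trans v x z : v \in C -> x \in C -> z \in C -> e v x -> e v z -> x != z -> e x z.
  move=> vC xC zC evx evz xz; apply: contraNT noP3 => nexz.
  apply/existsP; exists v; apply/existsP; exists x; apply/existsP; exists z.
  by rewrite vC xC zC evx evz xz nexz.
pose K := [set w in C | (w == a) || e a w].
have aK : a \in K by rewrite inE aC eqxx.
have clK : {in K & C, forall w w', e w w' -> w' \in K}.
  move=> w w'; rewrite !inE => /andP[wC /orP[/eqP->|eaw]] w'C eww'; rewrite w'C /=.
    by rewrite eww' orbT.
  have [//|w'a] := eqVneq w' a; apply: (trans w) => //; last by rewrite eq_sym.
  by rewrite e_sym.
have bK : b \notin K by rewrite inE negb_and negb_or eq_sym ab neab orbT.
have: pm K.
  apply: pm_restrict (fcC b bC).
    apply/subsetP => w wK; rewrite !inE; move: (wK); rewrite inE => /andP[-> _].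
    by rewrite andbT; apply: contraNneq bK => <-.
  by move=> w w' wK; rewrite inE => /andP[_]; apply: clK.
have: pm (K :\ a).
  apply: pm_restrict (fcC a aC).
    by apply: setSD; apply/subsetP => w; rewrite inE => /andP[].
  move=> w w'; rewrite !in_setD1 => /andP[_ wK] /andP[-> w'C] /=.
  exact: clK.
by move=> /pm_even pa /pm_even; rewrite (cardsD1 a) aK oddD (negPf pa).
Qed.

(* Gluing two parts at a cut vertex adds up both the degree sums and the numbers
   [#|C| - 1], so the bound reduces to complete sets of order at most [r]. *)
Lemma rigid_degree_sum r (C : {set T}) : C != set0 -> factor_critical C -> rigid C ->
  {in C, forall v, deg_in C v <= r} ->
  {in C &, forall x y, x != y -> e x y} /\ #|C| = r.+1 \/
  \sum_(v in C) deg_in C v + r <= r * #|C|.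
Proof.
have [n] := ubnP #|C|; elim: n C => // n IH C /ltnSE leC Cn0 fcC rC dC.
have [cC|] := boolP [forall x in C, forall y in C, (x != y) ==> e x y].
  have {}cC : {in C &, forall x y, x != y -> e x y}.
    by move=> x y xC yC; apply/implyP; apply: (forall_inP (forall_inP cC x xC)).
  have [c cinC] := set0Pn _ Cn0.
  have := dC c cinC; have := complete_deg_in cC cinC => dc ler.
  (* With [m = #|C|] the bound reads [m * (m - 1) + r <= r * m], true for [1 <= m <= r]. *)
  have [E|ne] := eqVneq #|C| r.+1; [by left|right].
  have -> : \sum_(v in C) deg_in C v = \sum_(v in C) #|C|.-1.
    by apply: eq_bigr => v vC; rewrite -(complete_deg_in cC vC).
  rewrite sum_nat_const; move: ne ler dc; clear.
  by move: #|C| (deg_in C c) => m d; nia.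
rewrite negb_forall_in => /exists_inP[a aC]; rewrite negb_forall_in => /exists_inP[b bC].
rewrite negb_imply => /andP[ab neab].
have [v [x [z [[vC xC zC] [evx evz xz nexz]]]]] :=
  factor_critical_not_complete fcC aC bC ab neab.
have [K [sK xK zK clK]] := rigid_cut fcC rC vC xC zC evx evz xz nexz.
pose L := C :\ v :\: K.
have sL : L \subset C :\ v by apply: subsetDl.
have clL : {in L & C :\ v, forall w w', e w w' -> w' \in L} := closed_setD sK clK.
have vz := edge_neq evz.
have zL : z \in L by rewrite !inE zK zC eq_sym vz.
have notv (M : {set T}) : M \subset C :\ v -> v \notin M.
  by move=> sM; apply/negP => /(subsetP sM); rewrite !inE eqxx.
have cCv := cardsD1 v C; rewrite vC in cCv.
have cKL : #|C :\ v| = #|K| + #|L|.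
  by rewrite -(cardsID K) (setIidPr sK).
have K0 : 0 < #|K| by apply/card_gt0P; exists x.
have L0 : 0 < #|L| by apply/card_gt0P; exists z.
have dv := deg_in_cut_vertex vC sK; rewrite -/L in dv.
have part (M : {set T}) : M \subset C :\ v -> {in M & C :\ v, forall w w', e w w' -> w' \in M} ->
    0 < #|M| < #|C :\ v| -> deg_in (v |: M) v < deg_in C v ->
    \sum_(w in M) deg_in C w + deg_in (v |: M) v <= r * #|M|.
  move=> sM clM /andP[M0 ltM] ltd.
  have cM : #|v |: M| = #|M|.+1 by rewrite cardsU1 notv.
  have dM : {in v |: M, forall w, deg_in (v |: M) w <= r}.
    move=> w /setU1P[->|wM]; first by rewrite (leq_trans (ltnW ltd)) // dC.
    rewrite (deg_in_cut_part vC sM clM wM) dC //.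
    by have := subsetP sM w wM; rewrite inE => /andP[].
  have [||[cpl card]|] := IH (v |: M) _ _ (factor_critical_cut fcC vC sM clM)
      (rigid_cut_part fcC rC vC sM clM) dM.
  - by rewrite cM; move: ltM leC cCv; clear; lia.
  - by apply/set0Pn; exists v; rewrite setU11.
  (* A complete part of order [r.+1] would already give [v] degree [r], contrary to [ltd] and
     [dC]. *)
  - have := complete_deg_in cpl (setU11 v M); rewrite card => -[] E.
    by move: ltd; rewrite E ltnNge dC.
  rewrite big_setU1 ?notv //= cM mulnS.
  rewrite (eq_bigr (deg_in C)) => [|w wM]; last exact: deg_in_cut_part.
  by rewrite addnC leq_add2l addnC.
have dA : 0 < deg_in (v |: K) v by apply: (deg_in_gt0 (w := x)); rewrite ?in_setU1 ?xK ?orbT.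
have dB : 0 < deg_in (v |: L) v by apply: (deg_in_gt0 (w := z)); rewrite ?in_setU1 ?zL ?orbT.
have ltK : 0 < #|K| < #|C :\ v| by rewrite K0 cKL -[X in X < _]addn0 ltn_add2l.
have ltL : 0 < #|L| < #|C :\ v| by rewrite L0 cKL -[X in X < _]add0n ltn_add2r.
have dAC : deg_in (v |: K) v < deg_in C v by rewrite dv -[X in X < _]addn0 ltn_add2l.
have dBC : deg_in (v |: L) v < deg_in C v by rewrite dv -[X in X < _]add0n ltn_add2r.
have pK := part K sK clK ltK dAC; have pL := part L sL clL ltL dBC.
right.
(* The two degrees of [v] add up, and [#|K| + #|L| = #|C| - 1] accounts for the summand [r]. *)
rewrite (big_setD1 v) //= (big_setID K) /= (setIidPr sK) -/L cCv cKL dv.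
rewrite mulnDr mulnDr muln1; move: pL pK; clear.
move: (deg_in _ _) (deg_in _ _) (\sum_(_ in K) _) (\sum_(_ in L) _) (r * _) (r * _) => *; lia.
Qed.

(** * Induced path decompositions of vertex sets *)

Definition ipd (U : {set T}) : Prop := exists P : {set {set T}},
  partition P U /\ forall S, S \in P -> induced_path_of_order_ge2 e S.

Lemma ipd0 : ipd set0.
Proof. by exists set0; split=> [|S]; rewrite ?inE // partition_set0. Qed.

Lemma ipdU (A B : {set T}) : [disjoint A & B] -> ipd A -> ipd B -> ipd (A :|: B).
Proof.
move=> dAB [P [/and3P[/eqP cP tP nP] pP]] [Q [/and3P[/eqP cQ tQ nQ] pQ]].
exists (P :|: Q); split; last by move=> S; rewrite inE => /orP[/pP|/pQ].
have dPQ X Y : X \in P -> Y \in Q -> [disjoint X & Y].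
  move=> XP YQ; apply: disjointWl (disjointWr _ dAB).
    by rewrite -cP; apply: bigcup_sup XP.
  by rewrite -cQ; apply: bigcup_sup YQ.
apply/and3P; split.
- by rewrite /cover bigcup_setU -/(cover P) -/(cover Q) cP cQ.
- apply/trivIsetP => X Y; rewrite !inE => /orP[XP|XQ] /orP[YP|YQ] XY.
  + exact: (trivIsetP tP).
  + exact: dPQ.
  + by rewrite disjoint_sym; apply: dPQ.
  + exact: (trivIsetP tQ).
- by rewrite inE negb_or nP nQ.
Qed.

Lemma ipd_path (S : {set T}) : induced_path_of_order_ge2 e S -> ipd S.
Proof.
move=> pS; exists [set S]; split; last by move=> X /set1P->.
apply/and3P; split; first by rewrite /cover big_set1.
  by apply/trivIsetP => X Y /set1P-> /set1P->; rewrite eqxx.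
by rewrite inE; apply/eqP => E; case: pS; rewrite -E cards0.
Qed.

Lemma ipd_edge x y : e x y -> ipd [set x; y].
Proof.
move=> exy; have xy := edge_neq exy; apply: ipd_path; split.
  by rewrite cards2 xy.
exists x, [:: x; y]; split.
- by rewrite /= inE xy.
- by apply/setP => z; rewrite !inE.
- by case=> [|[|i]] [|[|j]] //= _ _; rewrite ?e_irr ?exy // e_sym exy.
Qed.

Lemma ipd_induced_P3 x y z : e x y -> e y z -> x != z -> ~~ e x z ->
  ipd [set x; y; z].
Proof.
move=> exy eyz xz /negPf nexz; have xy := edge_neq exy; have yz := edge_neq eyz.
apply: ipd_path; split.
  by rewrite -setUA cardsU1 !inE negb_or xy xz cards2 yz.
exists x, [:: x; y; z]; split.
- by rewrite /= !inE negb_or xy xz yz.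
- by apply/setP => w; rewrite !inE -orbA.
- case=> [|[|[|i]]] [|[|[|j]]] //= _ _; rewrite ?e_irr ?exy ?eyz ?nexz //;
    by rewrite e_sym ?exy ?eyz ?nexz.
Qed.

Lemma ipd_add (A U : {set T}) : A \subset U -> ipd A -> ipd (U :\: A) -> ipd U.
Proof.
move=> sAU iA iU.
have -> : U = A :|: (U :\: A) by rewrite -{1}(setID U A) (setIidPr sAU).
apply: ipdU => //; apply/pred0P => w /=; rewrite inE.
by case: (w \in A).
Qed.

Lemma ipd_pm (U : {set T}) : pm U -> ipd U.
Proof.
have [n] := ubnP #|U|; elim: n U => // n IH U /ltnSE leU pU.
have [->|[x xU]] := set_0Vmem U; first exact: ipd0.
have [y [yU exy p]] := pm_partner pU xU.
apply: (ipd_add _ (ipd_edge exy)); first by rewrite subUset !sub1set xU.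
apply: IH p; apply: leq_trans leU; apply: proper_card.
by apply/properP; split; [apply: subsetDl | exists x => //; rewrite !inE eqxx].
Qed.

Lemma ipd_not_rigid (C : {set T}) : ~~ rigid C -> ipd C.
Proof.
rewrite negb_forall_in => /exists_inP[x xC]; rewrite negb_forall_in => /exists_inP[y yC].
rewrite negb_forall_in => /exists_inP[z zC]; rewrite negb_imply.
move=> /andP[/and4P[exy eyz xz p] nexz].
apply: (ipd_add _ (ipd_induced_P3 exy eyz xz nexz)) (ipd_pm p).
by rewrite !subUset !sub1set xC yC zC.
Qed.

(** * Edge counting in connected regular graphs *)

Lemma deg_in_sum_exchange (A B : {set T}) :
  \sum_(v in A) deg_in B v = \sum_(w in B) deg_in A w.
Proof.
have dgE X v : deg_in X v = \sum_(w in X) e v w.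
  rewrite /deg_in -sum1_card big_mkcond [RHS]big_mkcond; apply: eq_bigr => w _.
  by rewrite inE; case: (w \in X); case: (e v w).
under eq_bigr do rewrite dgE.
rewrite exchange_big /=; apply: eq_bigr => w _; rewrite dgE.
by apply: eq_bigr => v _; rewrite e_sym.
Qed.

Lemma connected_closed_setT (X : {set T}) x : connected e -> x \in X ->
  {in X, forall v w, e v w -> w \in X} -> X = setT.
Proof.
move=> con xX cX; apply/setP => y; rewrite inE.
have /connectP[p pp ->] := con x y.
elim: p x xX pp => [|z p IH] x xX //= /andP[exz]; apply: IH; exact: cX exz.
Qed.

(** Degree zero and connectedness leave a single vertex, a complete graph of odd order. *)
Lemma regular_gt0 r (x : T) : connected e -> regular e r -> ~ (complete e /\ odd #|T|) -> 0 < r.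
Proof.
move=> con reg ncpl; rewrite lt0n; apply/eqP => r0.
have noe v w : e v w -> False.
  move=> evw; have /eqP := reg v; rewrite r0 cards_eq0 => /eqP/setP/(_ w).
  by rewrite !inE evw.
have XT : [set x] = setT.
  by apply: (connected_closed_setT con (set11 x)) => v _ w /noe.
case: ncpl; split; last by rewrite -cardsT -XT cards1.
move=> u v; have := in_setT u; have := in_setT v; rewrite -XT => /set1P-> /set1P->.
by rewrite eqxx.
Qed.

(** A complete part on [r.+1] vertices uses up all its degrees, so by connectedness it is the whole
    graph, which is excluded since parts are odd. *)
Lemma rigid_part_surplus r S P f C : regular e r -> connected e ->
  ~ (complete e /\ odd #|T|) -> gallai_edmonds setT S P f ->
  C \in P -> rigid C -> \sum_(v in C) deg_in C v + r <= r * #|C|.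
Proof.
move=> reg con ncpl ge CP rC.
have oC := ge_odd ge CP; have fcC := ge_fc ge CP.
have Cn0 : C != set0 by apply: contraTneq oC => ->; rewrite cards0.
have dC : {in C, forall v, deg_in C v <= r}.
  move=> v _; rewrite -(reg v); apply/subset_leq_card/subsetP => w.
  by rewrite !inE => /andP[].
case: (rigid_degree_sum Cn0 fcC rC dC) => // -[cpl cardC]; case: ncpl.
have [x xC] := set0Pn _ Cn0.
have CT : C = setT.
  apply: (connected_closed_setT con xC) => v vC w evw.
  have E : [set u in C | e v u] = [set u | e v u].
    apply/eqP; rewrite eqEcard; apply/andP; split.
      by apply/subsetP => u; rewrite !inE => /andP[].
    by rewrite reg; have := complete_deg_in cpl vC; rewrite cardC => -[<-].
  by have := in_set (fun u => e v u) w; rewrite evw -E inE => /andP[].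
split; last by rewrite -cardsT -CT.
by move=> u v; apply: cpl; rewrite CT inE.
Qed.

(** Hall's condition by double counting: each rigid part of [Y] sends at least [r] edges to [N], and
    each vertex of [N] receives at most [r]. *)
Lemma rigid_parts_matching r (x0 : T) S P f : regular e r -> connected e ->
  ~ (complete e /\ odd #|T|) -> gallai_edmonds setT S P f ->
  exists g : {set T} -> T, {in [set C in P | rigid C] &, injective g} /\
    {in [set C in P | rigid C], forall C, (g C \in S) && adj_set C (g C)}.
Proof.
move=> reg con ncpl ge; have r0 := regular_gt0 x0 con reg ncpl.
apply: (hall_marriage x0 (R := fun C s => (s \in S) && adj_set C s)) => Y /subsetP sY.
set N := nbhd _ Y.
have sYP : Y \subset P by apply/subsetP => C /sY; rewrite inE => /andP[].
rewrite -(leq_pmul2l r0).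
have lower : r * #|Y| <= \sum_(C in Y) \sum_(v in C) deg_in N v.
  rewrite mulnC -sum_nat_const; apply: leq_sum => C CY.
  have CP := subsetP sYP C CY.
  have rC : rigid C by have := sY C CY; rewrite inE => /andP[].
  have := rigid_part_surplus reg con ncpl ge CP rC.
  (* Every neighbour of [v] lies in [C] or in [S], and those in [S] belong to [N]. *)
  have: \sum_(v in C) r <= \sum_(v in C) (deg_in C v + deg_in N v).
    apply: leq_sum => v vC; rewrite -(reg v).
    apply: leq_trans (_ : #|[set w in C | e v w] :|: [set w in N | e v w]| <= _); last first.
      by rewrite cardsU leq_subr.
    apply/subset_leq_card/subsetP => w; rewrite in_set => evw.
    rewrite in_setU !in_set evw !andbT.
    have := ge_nbhd ge CP vC (in_setT w) evw; rewrite in_setU => /orP[->//|wS].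
    apply/orP; right; apply/exists_inP; exists C => //; rewrite wS.
    by apply/exists_inP; exists v; rewrite // e_sym.
  rewrite big_split sum_nat_const mulnC /= -[X in _ -> _ <= X -> _]addn0.
  move: (r * _) (\sum_(_ in C) _) (\sum_(_ in C) _) => a b d; clear; lia.
apply: leq_trans lower _.
(* The parts are disjoint, so the double sum runs over the union of [Y] and can be counted from [N]
   instead. *)
rewrite -big_trivIset ?(trivIsetS sYP (ge_triv ge)) //=.
rewrite deg_in_sum_exchange mulnC -sum_nat_const; apply: leq_sum => w _.
rewrite -(reg w); apply/subset_leq_card/subsetP => v.
by rewrite !inE => /andP[].
Qed.

(** A part together with its matched vertex has a perfect matching; an unmatched part is not rigid
    and decomposes by itself. *)
Lemma ipd_of_matched_parts S P f h : gallai_edmonds setT S P f ->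
  {in S &, injective h} -> {in S, forall s, (h s \in P) && adj_set (h s) s} ->
  {in [set C in P | rigid C], forall C, exists2 s, s \in S & h s = C} ->
  ipd setT.
Proof.
move=> ge injh hP hrigid.
have PS C z : C \in P -> z \in C -> z \notin S.
  move=> CP zC; have : z \in cover P by apply/bigcupP; exists C.
  by rewrite (ge_cover ge) inE => /andP[].
(* Since [h] is injective on [S], at most one vertex is added to [C]. *)
pose F C := C :|: [set s in S | h s == C].
have -> : [set: T] = \bigcup_(C in P) F C.
  apply/esym/setP => z; rewrite inE; apply/bigcupP.
  have [zS|zS] := boolP (z \in S).
    by have /andP[hzP _] := hP z zS; exists (h z) => //; rewrite !inE zS eqxx orbT.
  have : z \in cover P by rewrite (ge_cover ge) !inE zS.
  by case/bigcupP => C CP zC; exists C => //; rewrite inE zC.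
apply: (bigcup_disjoint_ind ipd0 ipdU) => [C D CP DP CD|C CP].
  have /trivIsetP/(_ C D CP DP CD) dCD := ge_triv ge.
  apply/pred0P => z /=; rewrite !in_setU !in_set; apply/negP => /andP[].
  case/orP=> [zC|/andP[zS /eqP zC]]; case/orP=> [zD|/andP[zS' /eqP zD]].
  - by rewrite (disjointFr dCD zC) in zD.
  - by move: (PS C z CP zC); rewrite zS'.
  - by move: (PS D z DP zD); rewrite zS.
  - by rewrite -zC -zD eqxx in CD.
have [s /andP[sS /eqP hs]|nos] := pickP [pred s in S | h s == C].
  have -> : F C = s |: C.
    apply/setP => z; rewrite !inE orbC; congr (_ || _).
    apply/andP/eqP => [[zS /eqP hz]|->]; last by rewrite sS hs.
    by apply: injh; rewrite // hz hs.
  have /andP[_ /exists_inP[c]] := hP s sS; rewrite hs => cC esc.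
  apply: ipd_pm; apply: (pm_add (x := s) (y := c)) => //; rewrite ?setU11 //.
    by rewrite in_setU1 cC orbT.
  have -> : (s |: C) :\: [set s; c] = C :\ c; last exact: (ge_fc ge).
  have sC : s \notin C by apply/negP => /(PS C s CP); rewrite sS.
  by set_ext.
have -> : F C = C.
  apply/setP => z; rewrite !inE; have := nos z; rewrite inE /= => ->.
  by rewrite orbF.
apply: ipd_not_rigid; apply/negP => rC.
have [|s sS hs] := hrigid C; first by rewrite inE CP.
by have := nos s; rewrite inE /= sS hs eqxx.
Qed.

End Matching.

(** * Combination of the two matchings *)

Theorem mainTheorem2 (T : finType) (e : rel T) (r : nat) :
  simple_graph e -> connected e -> regular e r ->
  ~ (complete e /\ odd #|T|) ->
  has_IPD e.
Proof.
move=> [e_sym e_irr] con reg ncpl.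
(* The empty graph is set apart because matching the rigid parts takes a default vertex [x0]. *)
have [T0|[x0 _]] := set_0Vmem [set: T].
  by rewrite /has_IPD T0; apply: ipd0.
have [S [P [f ge]]] := gallai_edmonds_exists e_sym e_irr setT.
have [g [injg gP]] := rigid_parts_matching e_sym e_irr x0 reg con ncpl ge.
pose R s C := (C \in P) && adj_set e C s.
have [C CP|h [injh hP hrigid]] :=
    merge_matchings (R := R) (ge_inj ge) (ge_match ge) injg.
  have /andP[gS ag] := gP C CP; rewrite gS /R ag andbT.
  by move: CP; rewrite inE => /andP[].
exact: ipd_of_matched_parts ge injh hP hrigid.
Qed.
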